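(* Let $n\ge2$ and let $A_n=(a_1,\ldots,a_n)$ be a regular discount sequence with $a_i>0$ for all $i=1,\ldots,n$. Let $\alpha$ be a finite nonnull measure on $\mathbf{R}$ with a finite first moment. Then the break-even observation and the break-even value satisfy $$b(\alpha;A_n)\ge\Lambda(\alpha;A_n).$$
   Context: All measures are Borel measures on $\mathbf{R}$; a measure $\alpha$ has a finite first moment (finite mean) if $\int |x|\,d\alpha(x)<\infty$. $\delta_x$ is the point mass at $x$. A discount sequence is $A_n=(a_1,\ldots,a_n)$ with $a_i\ge0$ and $\sum_{i=1}^n a_i>0$. Dirichlet bandit $(\alpha_1,\alpha_2;A_n)$: at each of $n$ stages one of two arms is selected, sequentially, based on past observations. Observations from arm $i$ are independent draws from $P_i$ given $P_i$, where $P_1,P_2$ are independent random probability measures, $P_i$ having a Dirichlet process prior ${\rm DP}(\alpha_i)$, with $\alpha_i$ a finite nonnull measure with finite first moment. The payoff is $\sum_{i=1}^n a_iZ_i$, where $Z_i$ is the observation at stage $i$. $W(\alpha_1,\alpha_2;A_n)$ denotes the maximum expected payoff over all strategies, and $W^i(\alpha_1,\alpha_2;A_n)$ the expected payoff when arm $i$ is selected initially and an optimal strategy is used thereafter. Equivalently (for all finite sequences of nonnegative reals): $W=0$ for the empty sequence, and for $n\ge1$, with $A_n^1=(a_2,\ldots,a_n)$, $$W(\alpha_1,\alpha_2;A_n)=\max\{W^1(\alpha_1,\alpha_2;A_n),W^2(\alpha_1,\alpha_2;A_n)\},$$ $$W^1(\alpha_1,\alpha_2;A_n)=a_1\mu_1+E[W(\alpha_1+\delta_X,\alpha_2;A_n^1)\,|\,\alpha_1],$$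 $$W^2(\alpha_1,\alpha_2;A_n)=a_1\mu_2+E[W(\alpha_1,\alpha_2+\delta_Y;A_n^1)\,|\,\alpha_2],$$ where $E[g(X)|\alpha]$ means that $X$ has distribution $\alpha/\alpha(\mathbf{R})$, and $\mu_i=\int x\,d\alpha_i(x)/\alpha_i(\mathbf{R})$. Arm $i$ is optimal initially if $W=W^i$. One-armed bandit: $(\alpha,\delta_\lambda;A_n)$ with $\lambda\in\mathbf{R}$; arm 2 yields the constant payoff $\lambda$ at each stage. Regular: with the convention $a_i=0$ for $i>n$, the sequence $A_n$ is regular if $(\sum_{i\ge j+1}a_i)^2\ge(\sum_{i\ge j}a_i)(\sum_{i\ge j+2}a_i)$ for all $j\ge1$. (Then $A_n^1$ also satisfies this condition.) Break-even value: for $A_n$ regular, $\Lambda(\alpha;A_n)$ denotes the (necessarily unique) real number such that, for every $\lambda\in\mathbf{R}$, in the $(\alpha,\delta_\lambda;A_n)$ bandit arm 1 is optimal initially if and only if $\lambda\le\Lambda(\alpha;A_n)$, and arm 2 is optimal initially if and only if $\lambda\ge\Lambda(\alpha;A_n)$. (The existence of the break-even value is taken as known.) Break-even observation: $b(\alpha;A_n)$ is the real number such that, for $x\in\mathbf{R}$, $\Lambda(\alpha;A_n)\ge\Lambda(\alpha+\delta_x;A_n^1)$ if $x\le b(\alpha;A_n)$, and $\Lambda(\alpha;A_n)\le\Lambda(\alpha+\delta_x;A_n^1)$ if $x\ge b(\alpha;A_n)$. (Its existence, and its uniqueness when $n\ge2$ and $A_n$ is regular and all positive, are taken as known.) *)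

(* Defs.v *)
From HB Require Import structures.
From mathcomp Require Import all_boot all_order all_algebra.
From mathcomp Require Import all_classical all_reals all_analysis.

Set Implicit Arguments.
Unset Strict Implicit.
Unset Printing Implicit Defensive.

Import Order.TTheory GRing.Theory Num.Theory.
Import numFieldNormedType.Exports.

Local Open Scope classical_set_scope.
Local Open Scope ring_scope.

Notation borel_measure R := {measure set (measurableTypeR R) -> \bar R}.

Section Bandit.
Context {R : realType}.
Implicit Types (A : seq R) (al be : borel_measure R).

(* The parameter of the posterior of DP(al) after the observation x. *)
Definition posterior al (x : R) : borel_measure R :=
  measure_add al (dirac (x : measurableTypeR R)).

(* E[g(X) | al], where X has distribution al / al(R).  All the integrals met
   below are finite when the parameters are finite, nonnull and have a finite
   first moment, so that real-valued integrals lose nothing. *)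
Definition expect al (g : R -> R) : R :=
  (\int[al]_(x in setT) g x) / fine (al setT).

(* The discount sequence (a_1, ..., a_n) is the list a_1 :: ... :: a_n. *)
Fixpoint W A al be : R :=
  if A is a :: A' then
    Num.max (a * expect al id + expect al (fun x => W A' (posterior al x) be))
            (a * expect be id + expect be (fun y => W A' al (posterior be y)))
  else 0.

Definition W1 A al be : R :=
  head 0 A * expect al id
  + expect al (fun x => W (behead A) (posterior al x) be).

Definition W2 A al be : R :=
  head 0 A * expect be id
  + expect be (fun y => W (behead A) al (posterior be y)).

Lemma W_nil al be : W [::] al be = 0.
Proof. by []. Qed.

Lemma W_cons a A al be :
  W (a :: A) al be = Num.max (W1 (a :: A) al be) (W2 (a :: A) al be).
Proof. by []. Qed.

Definition arm1_optimal A al be : Prop := W A al be = W1 A al be.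
Definition arm2_optimal A al be : Prop := W A al be = W2 A al be.

(* The point mass at lambda, as the parameter of the known arm. *)
Definition known_arm (lambda : R) : borel_measure R :=
  dirac (lambda : measurableTypeR R).

(* The sum of a_i over i > j, for a_1, ..., a_n the entries of A; the
   positions in A are counted from 0. *)
Definition discount_tail A (j : nat) : R := \sum_(j <= i < size A) A`_i.

Definition regular A : Prop := forall j : nat,
  discount_tail A j * discount_tail A j.+2 <= discount_tail A j.+1 ^+ 2.

(* L is the break-even value of (al; A). *)
Definition is_break_even_value A al (L : R) : Prop :=
  forall lambda : R,
    (arm1_optimal A al (known_arm lambda) <-> lambda <= L) /\
    (arm2_optimal A al (known_arm lambda) <-> L <= lambda).

Lemma is_break_even_value_uniq A al (L L' : R) :
  is_break_even_value A al L -> is_break_even_value A al L' -> L = L'.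
Proof.
move=> HL HL'; apply/eqP; rewrite eq_le; apply/andP; split.
  by apply/(proj1 (HL' L))/(proj1 (HL L)).
by apply/(proj1 (HL L'))/(proj1 (HL' L')).
Qed.

(* b is a break-even observation of (al; A).  L and Lx x are the break-even
   values of (al; A) and of (al + delta_x; A without its first entry); by
   is_break_even_value_uniq they are the only possible ones. *)
Definition is_break_even_observation A al (b : R) : Prop :=
  exists (L : R) (Lx : R -> R),
    [/\ is_break_even_value A al L,
        forall x, is_break_even_value (behead A) (posterior al x) (Lx x),
        forall x, x <= b -> Lx x <= L
      & forall x, b <= x -> L <= Lx x].

End Bandit.

(* Main.v *)
Require Import Defs.
From HB Require Import structures.
From mathcomp Require Import all_boot all_order all_algebra.
From mathcomp Require Import all_classical all_reals all_analysis.
From mathcomp Require Import measurable_realfun ring lra.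

Set Implicit Arguments.
Unset Strict Implicit.
Unset Printing Implicit Defensive.

Import Order.TTheory GRing.Theory Num.Theory.
Import numFieldNormedType.Exports.

Local Open Scope classical_set_scope.
Local Open Scope ring_scope.

(** Let lam be the payoff of the known arm.  Subtract from the value of the
    bandit what the known arm alone would bring, lam times the sum of the
    discounts.  The difference is the [adv] below; it is nonnegative and
    satisfies

      adv (a :: A) alpha =
        max (a (mu - lam) + E[adv A (alpha + delta_X)]) (adv A alpha),

    the first term ([pull_adv]) belonging to arm 1, the second to arm 2.

    Two facts about this recursion give the theorem.

    - Delay is costly ([adv_delay]).  For a regular sequence a :: A with
      positive entries, adv A alpha <= c adv (a :: A) alpha with
      c = (sum of A) / (sum of a :: A) < 1.  If arm 2 is optimal initially, so
      that adv (a :: A) alpha = adv A alpha, then adv A alpha = 0: there is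
      nothing to be gained from arm 1, now or later.

    - An observation x <= lam never helps ([adv_posterior_le]).  Under
      alpha + delta_x the next observation is drawn from alpha with probability
      M / (M + 1), where M is the mass of alpha, and otherwise equals x.  In the
      second case the immediate gain x - lam is at most 0 and one more useless
      observation is added; in the first case induction applies after the draw.
      So pulling arm 1 under alpha + delta_x yields at most
      adv A alpha + a (x - lam) / (M + 1), a being the first entry of A
      ([pull_adv_posterior_le]).

    Now take lam = L, the break-even value, so that arm 2 is optimal initially
    and adv A' alpha = 0, A' being A without its first entry.  If b < L, choose
    x strictly between them.  As x >= b, the break-even value of
    (alpha + delta_x; A') is at least L, hence arm 1 is optimal there for
    lam = L, so that pull_adv equals adv there and is nonnegative.  But by the
    second fact it is at most a positive multiple of x - L < 0.

    The analytic part of the file ensures that the expectations in the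
    recursion are those of integrable functions: x |-> adv A (alpha + delta_x)
    is Lipschitz, which gives both its measurability and its integrability
    against a finite measure with a finite first moment. *)

Section BreakEven.
Context {R : realType}.
Implicit Types (A : seq R) (al be : borel_measure R) (f g : R -> R).

(** * Expectations of Lipschitz functions *)

Definition admissible al : Prop :=
  [/\ (al setT < +oo)%E, (0 < al setT)%E
    & (\int[al]_(x in setT) `|x|%:E < +oo)%E].

Definition mass al : R := fine (al setT).

(** A class of functions closed under the operations of the recursion, and
    integrable against every finite measure with a finite first moment. *)
Definition is_lipschitz f : Prop :=
  exists C : R, forall x y, `|f x - f y| <= C * `|x - y|.

Lemma is_lipschitz_le (C : R) f :
  (forall x y, f x <= f y + C * `|x - y|) -> is_lipschitz f.
Proof.
move=> fC; exists C => x y; rewrite ler_norml lerBlDl fC andbT.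
by rewrite lerNl opprB lerBlDl distrC fC.
Qed.

Lemma is_lipschitz_cst (c : R) : is_lipschitz (cst c).
Proof. by exists 0 => x y; rewrite subrr normr0 mul0r. Qed.

Lemma is_lipschitz_id : is_lipschitz id.
Proof. by exists 1 => x y; rewrite mul1r. Qed.

Lemma is_lipschitzD f g : is_lipschitz f -> is_lipschitz g -> is_lipschitz (f \+ g).
Proof.
move=> [C fC] [D gD]; exists (C + D) => x y /=.
rewrite opprD addrACA mulrDl (le_trans (ler_normD _ _))//.
by rewrite lerD.
Qed.

Lemma is_lipschitzZ (c : R) f : is_lipschitz f -> is_lipschitz (fun x => c * f x).
Proof.
move=> [C fC]; exists (`|c| * C) => x y.
by rewrite -mulrBr normrM -mulrA ler_wpM2l.
Qed.

Lemma is_lipschitz_measurable f :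
  is_lipschitz f ->
  measurable_fun [set: measurableTypeR R] (f : measurableTypeR R -> R).
Proof.
move=> [C fC]; apply: continuous_measurable_fun => x.
apply/cvgrPdist_le => e e0; near=> y.
rewrite (le_trans (fC x y))//.
have C0 : 0 < `|C| + 1 by rewrite ltr_wpDl.
have : `|x - y| <= e / (`|C| + 1).
  near: y; apply: cvgr_dist_le => //; exact: divr_gt0.
rewrite ler_pdivlMr// => h; rewrite (le_trans _ h)// mulrC ler_wpM2l//.
by rewrite (le_trans (ler_norm C))// lerDl.
Unshelve. all: by end_near. Qed.

Lemma is_lipschitz_integrable al f :
  admissible al -> is_lipschitz f -> al.-integrable setT (EFin \o f).
Proof.
move=> [aloo _ alm] fl; have [C fC] := fl.
have absI : al.-integrable setT (EFin \o (fun x : measurableTypeR R => `|x| : R)).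
  apply/integrableP; split.
    by apply/measurable_EFinP; exact: normr_measurable.
  by under eq_integral do rewrite /= normr_id.
have cstI (k : R) : al.-integrable setT (EFin \o (fun _ : measurableTypeR R => k)).
  apply/integrableP; split; first exact/measurable_EFinP.
  by rewrite /= integral_cst//= lte_mul_pinfty.
have := integrableD measurableT (cstI `|f 0|) (integrableZl measurableT C absI).
apply: le_integrable => //.
  by apply/measurable_EFinP; exact: is_lipschitz_measurable.
move=> x _ /=; rewrite lee_fin.
have := fC x 0; rewrite subr0 => h.
have := ler_norm (`|f 0| + C * `|x|).
by apply: le_trans; rewrite -lerBlDl (le_trans _ h)// lerB_dist.
Qed.

Lemma mass_gt0 al : admissible al -> 0 < mass al.
Proof. by move=> [aloo al0 _]; rewrite /mass fine_gt0// aloo al0. Qed.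

Lemma posteriorE al x (U : set (measurableTypeR R)) :
  posterior al x U = (al U + \d_(x : measurableTypeR R) U)%E.
Proof. exact: measure_addE. Qed.

Lemma posterior_setT al x : posterior al x setT = (al setT + 1)%E.
Proof. by rewrite posteriorE diracT. Qed.

Lemma mass_posterior al x :
  admissible al -> mass (posterior al x) = mass al + 1.
Proof.
move=> [aloo al0 _].
by rewrite /mass posterior_setT fineD// ge0_fin_numE.
Qed.

Lemma admissible_posterior al x : admissible al -> admissible (posterior al x).
Proof.
move=> [aloo al0 alm]; split.
- by rewrite posterior_setT lte_add_pinfty// ltry.
- by rewrite posterior_setT; apply: adde_gt0 => //; rewrite lte_fin ltr01.
- have -> : (\int[posterior al x]_(t in setT) `|t|%:E =
      \int[al]_(t in setT) `|t|%:E +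
      \int[\d_(x : measurableTypeR R)]_(t in setT) `|t|%:E)%E.
    apply: ge0_integral_measure_add => //.
    by apply/measurable_EFinP; exact: normr_measurable.
  rewrite lte_add_pinfty// integral_dirac//; last first.
    by apply/measurable_EFinP; exact: normr_measurable.
  by rewrite diracT mul1e ltry.
Qed.

Lemma posteriorC al x y :
  posterior (posterior al x) y = posterior (posterior al y) x.
Proof.
apply: eq_measure; apply/funext => U.
by rewrite !posteriorE -!addeA; congr (_ + _)%E; rewrite addeC.
Qed.

Lemma expect_cst al (c : R) : admissible al -> expect al (cst c) = c.
Proof.
move=> ala; rewrite /expect Rintegral_cst// mulfK//.
by rewrite gt_eqF// mass_gt0.
Qed.

Lemma expectD al f g : admissible al -> is_lipschitz f -> is_lipschitz g ->
  expect al (f \+ g) = expect al f + expect al g.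
Proof.
move=> ala fl gl; rewrite /expect RintegralD ?mulrDl//; exact: is_lipschitz_integrable.
Qed.

Lemma expectZ al (c : R) f : admissible al -> is_lipschitz f ->
  expect al (fun x => c * f x) = c * expect al f.
Proof.
by move=> ala fl; rewrite /expect RintegralZl ?mulrA//; exact: is_lipschitz_integrable.
Qed.

Lemma le_expect al f g : admissible al -> is_lipschitz f -> is_lipschitz g ->
  (forall x, f x <= g x) -> expect al f <= expect al g.
Proof.
move=> ala fl gl fg; rewrite /expect ler_pM2r ?invr_gt0 ?mass_gt0//.
by apply: le_Rintegral => //; exact: is_lipschitz_integrable.
Qed.

(** Prediction from alpha + delta_x: a draw from alpha with probability
    M / (M + 1), the value x with probability 1 / (M + 1). *)
Lemma expect_posterior al x f : admissible al -> is_lipschitz f ->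
  (mass al + 1) * expect (posterior al x) f = mass al * expect al f + f x.
Proof.
move=> ala fl; rewrite /expect.
have := mass_posterior x ala; rewrite {1}/mass => ->.
have M0 := mass_gt0 ala.
rewrite mulrCA divff ?mulr1 ?gt_eqF ?addr_gt0//.
rewrite -/(mass al) mulrCA divff ?mulr1 ?gt_eqF//.
have mf : measurable_fun [set: measurableTypeR R] (EFin \o f).
  by apply/measurable_EFinP; exact: is_lipschitz_measurable.
rewrite /Rintegral.
have -> : (\int[posterior al x]_(t in setT) (f t)%:E =
      \int[al]_(t in setT) (f t)%:E +
      \int[\d_(x : measurableTypeR R)]_(t in setT) (f t)%:E)%E.
  apply: integral_measure_add => //; first exact: is_lipschitz_integrable.
  apply/integrableP; split=> //.
  rewrite integral_dirac//; last exact: measurableT_comp.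
  by rewrite diracT mul1e ltry.
rewrite integral_dirac// diracT mul1e fineD//.
by apply: integrable_fin_num => //; exact: is_lipschitz_integrable.
Qed.

(** * The known arm *)

(** The parameter of arm 2 is delta_lam at first and becomes 2 delta_lam,
    3 delta_lam and so on as arm 2 is observed. *)
Definition point_mass (lam : R) be : Prop :=
  exists2 c : R, 0 < c & forall U : set (measurableTypeR R), measurable U ->
    be U = (c%:E * \d_(lam : measurableTypeR R) U)%E.

Lemma point_mass_known lam : point_mass lam (known_arm lam).
Proof. by exists 1 => // U _; rewrite mul1e. Qed.

Lemma point_mass_posterior lam be :
  point_mass lam be -> point_mass lam (posterior be lam).
Proof.
move=> [c c0 beE]; exists (c + 1); first by rewrite addr_gt0.
move=> U mU; rewrite posteriorE beE// EFinD ge0_muleDl ?mul1e// lee_fin ltW//.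
Qed.

Section point_mass_integral.
Import HBNNSimple.

(** f is arbitrary because {lam} is measurable: the integral of f, a supremum
    over the simple functions below f, is already reached by those supported
    by {lam}.  The continuation value, as a function of an observation of
    arm 2, can thus be integrated as it is. *)
Lemma ge0_integral_point_mass lam be (c : R) (f : R -> \bar R) : 0 < c ->
    (forall U : set (measurableTypeR R), measurable U ->
      be U = (c%:E * \d_(lam : measurableTypeR R) U)%E) ->
    (forall x, 0 <= f x)%E ->
  (\int[be]_(x in setT) f x = c%:E * f lam)%E.
Proof.
move=> c0 beE f0.
pose k := NngNum (ltW c0).
have intE (D : set (measurableTypeR R)) (g : measurableTypeR R -> \bar R) :
    measurable D -> measurable_fun D g -> (forall x, 0 <= g x)%E ->
    (\int[be]_(x in D) g x = c%:E * (\d_(lam : measurableTypeR R) D * g lam))%E.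
  move=> mD mg g0.
  rewrite (eq_measure_integral (mscale k \d_(lam : measurableTypeR R))); last first.
    by move=> U mU _; exact: beE.
  by rewrite ge0_integral_mscale// integral_dirac.
apply/eqP; rewrite eq_le; apply/andP; split.
  rewrite ge0_integralE//; apply: ge_ereal_sup => _ [h /= hf] <-.
  rewrite -integralT_nnsfun intE//.
  - rewrite diracT mul1e lee_wpmul2l ?lee_fin ?(ltW c0)//.
    by have := hf lam; rewrite patch_setT.
  - exact/measurable_EFinP.
  - by move=> x; rewrite lee_fin.
have -> : (c%:E * f lam = \int[be]_(x in [set lam : measurableTypeR R]) f x)%E.
  rewrite (_ : (\int[be]_(x in [set lam : measurableTypeR R]) f x =
     \int[be]_(x in [set lam : measurableTypeR R]) f lam)%E).
    rewrite intE//.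
    by rewrite diracE mem_set// mul1e.
  by apply: eq_integral => x; rewrite inE => ->.
rewrite !ge0_integralE//; apply: ge_ereal_sup => _ [h /= hf] <-.
apply: ereal_sup_ubound; exists h => //= x.
apply: le_trans (hf x) _; rewrite patch_setT patchE.
by case: ifP.
Qed.

End point_mass_integral.

Lemma expect_point_mass lam be g : point_mass lam be -> expect be g = g lam.
Proof.
move=> [c c0 beE]; rewrite /expect /Rintegral.
rewrite integralE !(ge0_integral_point_mass c0 beE)//.
rewrite beE// diracT mule1 -muleBr//=; last exact: add_def_funeposneg.
have -> : ((EFin \o g)^\+ lam - (EFin \o g)^\- lam = (g lam)%:E)%E.
  by rewrite -[RHS]/((EFin \o g) lam) [in RHS](funeposneg (EFin \o g)).
by rewrite /= mulrC mulKf// gt_eqF.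
Qed.

(** * The advantage over the known arm *)

(** The excess of the value of the (al, delta_lam; A) bandit over the payoff
    of the strategy that always selects the known arm; see [W_adv]. *)
Fixpoint adv (lam : R) A al : R :=
  if A is a :: A' then
    Num.max (a * (expect al id - lam)
              + expect al (fun x => adv lam A' (posterior al x)))
            (adv lam A' al)
  else 0.

Definition pull_adv (lam : R) A al : R :=
  head 0 A * (expect al id - lam)
  + expect al (fun x => adv lam (behead A) (posterior al x)).

Lemma adv_cons lam a A al :
  adv lam (a :: A) al = Num.max (pull_adv lam (a :: A) al) (adv lam A al).
Proof. by []. Qed.

Lemma adv_ge0 lam A al : 0 <= adv lam A al.
Proof. by elim: A al => //= a A IH al; rewrite le_max IH orbT. Qed.

(** The constant must not depend on al: the induction uses the bound for all the
    posteriors of al at once.  It is obtained for one stage more from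
    C |x - y| when the next draw comes from al, and from 2 C |x - y| when it
    repeats x, since then two atoms move from x to y. *)
Lemma adv_posterior_lipschitz_bound lam A :
  exists2 C : R, 0 <= C & forall al x y,
  admissible al ->
  adv lam A (posterior al x) <= adv lam A (posterior al y) + C * `|x - y|.
Proof.
elim: A => [|a A [C C0 IH]]; first by exists 0 => // al x y _ /=; rewrite mul0r addr0.
have lipF al : admissible al -> is_lipschitz (fun x => adv lam A (posterior al x)).
  by move=> ala; apply: (@is_lipschitz_le C) => x y; exact: IH.
exists (`|a| + 2 * C); first by rewrite addr_ge0 ?mulr_ge0.
move=> al x y ala; rewrite !adv_cons.
have d0 : 0 <= `|x - y| by [].
have a0 : 0 <= `|a| by [].
have ad0 : 0 <= `|a| * `|x - y| by rewrite mulr_ge0.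
have Cd0 : 0 <= C * `|x - y| by rewrite mulr_ge0.
rewrite ge_max; apply/andP; split; last first.
  apply: (le_trans (IH al x y ala)); apply: lerD; first by rewrite le_max lexx orbT.
  by rewrite mulrDl -mulrA; lra.
apply: (@le_trans _ _ (pull_adv lam (a :: A) (posterior al y)
    + (`|a| + 2 * C) * `|x - y|)); last first.
  by rewrite lerD2r le_max lexx.
rewrite /pull_adv /=.
have M0 := mass_gt0 ala.
have M1 : 0 < mass al + 1 by rewrite addr_gt0.
have scaled z : (mass al + 1) * (a * (expect (posterior al z) id - lam)
      + expect (posterior al z) (fun t => adv lam A (posterior (posterior al z) t)))
    = a * (mass al * expect al id + z - (mass al + 1) * lam)
      + (mass al * expect al (fun t => adv lam A (posterior (posterior al z) t))
         + adv lam A (posterior (posterior al z) z)).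
  rewrite -(expect_posterior _ ala is_lipschitz_id).
  rewrite -(expect_posterior _ ala (lipF _ (admissible_posterior z ala))).
  by ring.
rewrite -(ler_pM2l M1) [leRHS]mulrDr !scaled.
set Fx := expect al (fun t => adv lam A (posterior (posterior al x) t)).
set Fy := expect al (fun t => adv lam A (posterior (posterior al y) t)).
have FF : Fx <= Fy + C * `|x - y|.
  rewrite -[X in _ <= _ + X](expect_cst _ ala) -expectD//;
    try exact: is_lipschitz_cst; try exact/lipF/admissible_posterior.
  apply: le_expect => //; first exact/lipF/admissible_posterior.
    apply: is_lipschitzD; last exact: is_lipschitz_cst.
    exact/lipF/admissible_posterior.
  move=> z /=; rewrite posteriorC (posteriorC _ y).
  exact/IH/admissible_posterior.
(* Move the two atoms at x to y one at a time. *)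
have GG : adv lam A (posterior (posterior al x) x) <=
          adv lam A (posterior (posterior al y) y) + 2 * (C * `|x - y|).
  have := IH _ x y (admissible_posterior x ala).
  have := IH _ x y (admissible_posterior y ala).
  rewrite (posteriorC _ x y); lra.
have axy : a * x - a * y <= `|a| * `|x - y|.
  by rewrite -mulrBr -normrM ler_norm.
have MF := ler_wpM2l (ltW M0) FF.
have MC : 0 <= mass al * (C * `|x - y|) by rewrite mulr_ge0// ltW.
have Ma : 0 <= mass al * (`|a| * `|x - y|) by rewrite mulr_ge0// ltW.
nra.
Qed.

Lemma is_lipschitz_adv lam A al :
  admissible al -> is_lipschitz (fun x => adv lam A (posterior al x)).
Proof.
move=> ala; have [C _ H] := adv_posterior_lipschitz_bound lam A.
by apply: (@is_lipschitz_le C) => x y; exact: H.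
Qed.

(** * Reduction of the bandit to its advantage *)

Definition total A : R := \sum_(a <- A) a.

Lemma total_cons a A : total (a :: A) = a + total A.
Proof. exact: big_cons. Qed.

Lemma total_ge0 A : all (> 0) A -> 0 <= total A.
Proof.
move=> /allP A0; rewrite /total big_seq; apply: sumr_ge0 => a aA.
exact/ltW/A0.
Qed.

Lemma discount_tail0 A : discount_tail A 0 = total A.
Proof. by rewrite /total (big_nth 0). Qed.

Lemma discount_tail_cons a A j : discount_tail (a :: A) j.+1 = discount_tail A j.
Proof. by rewrite /discount_tail /= big_add1. Qed.

Lemma regular_behead a A : regular (a :: A) -> regular A.
Proof. by move=> reg j; have := reg j.+1; rewrite !discount_tail_cons. Qed.

(** Stated for all parameters of both arms, since both change from one stage
    to the next. *)
Definition reduces_to_adv lam A : Prop := forall al be,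
  admissible al -> point_mass lam be -> W A al be = adv lam A al + lam * total A.

Lemma W1_adv_step lam a A al be : reduces_to_adv lam A ->
  admissible al -> point_mass lam be ->
  W1 (a :: A) al be = pull_adv lam (a :: A) al + lam * total (a :: A).
Proof.
move=> WA ala beP; rewrite /W1 /pull_adv /=.
rewrite (_ : (fun x => W A (posterior al x) be) =
  (fun x => adv lam A (posterior al x)) \+ cst (lam * total A)); last first.
  by apply/funext => x /=; rewrite WA//; exact: admissible_posterior.
rewrite expectD//; [|exact: is_lipschitz_adv|exact: is_lipschitz_cst].
by rewrite expect_cst// total_cons; ring.
Qed.

Lemma W2_adv_step lam a A al be : reduces_to_adv lam A ->
  admissible al -> point_mass lam be ->
  W2 (a :: A) al be = adv lam A al + lam * total (a :: A).
Proof.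
move=> WA ala beP; rewrite /W2 /= !(expect_point_mass _ beP).
by rewrite WA//; [rewrite total_cons; ring|exact: point_mass_posterior].
Qed.

Lemma W_adv lam A : reduces_to_adv lam A.
Proof.
elim: A => [|a A IH] al be ala beP.
  by rewrite W_nil /total big_nil mulr0 addr0.
by rewrite W_cons (W1_adv_step _ IH)// (W2_adv_step _ IH)// -addr_maxl adv_cons.
Qed.

Lemma arm1_optimal_adv lam a A al : admissible al ->
  arm1_optimal (a :: A) al (known_arm lam) ->
  adv lam (a :: A) al = pull_adv lam (a :: A) al.
Proof.
move=> ala; rewrite /arm1_optimal.
have kP := point_mass_known lam.
rewrite (W_adv _ ala kP) (W1_adv_step _ (W_adv A) ala kP).
exact: addIr.
Qed.

Lemma arm2_optimal_adv lam a A al : admissible al ->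
  arm2_optimal (a :: A) al (known_arm lam) ->
  adv lam (a :: A) al = adv lam A al.
Proof.
move=> ala; rewrite /arm2_optimal.
have kP := point_mass_known lam.
rewrite (W_adv _ ala kP) (W2_adv_step _ (W_adv A) ala kP).
exact: addIr.
Qed.

(** * The cost of a delay *)

Lemma posterior_mean al : admissible al ->
  (fun x => expect (posterior al x) id) =
  cst (mass al / (mass al + 1) * expect al id)
    \+ (fun x => (mass al + 1)^-1 * x).
Proof.
move=> ala; have M0 := mass_gt0 ala.
have M1 : mass al + 1 != 0 by rewrite gt_eqF// addr_gt0.
apply/funext => x /=; apply: (mulfI M1).
rewrite expect_posterior//; last exact: is_lipschitz_id.
by field.
Qed.

Lemma is_lipschitz_posterior_mean al : admissible al ->
  is_lipschitz (fun x => expect (posterior al x) id).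
Proof.
move=> ala; rewrite posterior_mean//; apply: is_lipschitzD.
  exact: is_lipschitz_cst.
exact/is_lipschitzZ/is_lipschitz_id.
Qed.

(** The posterior means form a martingale. *)
Lemma expect_posterior_mean al : admissible al ->
  expect al (fun x => expect (posterior al x) id) = expect al id.
Proof.
move=> ala; have M0 := mass_gt0 ala.
have M1 : mass al + 1 != 0 by rewrite gt_eqF// addr_gt0.
rewrite posterior_mean// expectD//; last 2 first.
- exact: is_lipschitz_cst.
- exact/is_lipschitzZ/is_lipschitz_id.
rewrite expect_cst// expectZ//; last exact: is_lipschitz_id.
by rewrite /=; field.
Qed.

(** The left-hand side is the advantage of selecting arm 1 at all stages. *)
Lemma always_pull_le_adv lam A al : admissible al ->
  total A * (expect al id - lam) <= adv lam A al.
Proof.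
elim: A al => [|a A IH] al ala; first by rewrite /total big_nil mul0r.
rewrite adv_cons le_max; apply/orP; left; rewrite /pull_adv /= total_cons mulrDl.
rewrite lerD2l.
have cL : is_lipschitz (fun x => total A * (expect (posterior al x) id - lam)).
  apply: is_lipschitzZ; apply: is_lipschitzD (is_lipschitz_cst _).
  exact: is_lipschitz_posterior_mean.
apply: (@le_trans _ _
    (expect al (fun x => total A * (expect (posterior al x) id - lam)))).
  rewrite expectZ//; last first.
    apply: is_lipschitzD (is_lipschitz_cst _).
    exact: is_lipschitz_posterior_mean.
  rewrite (expectD (g := cst (- lam)))//; last 2 first.
  - exact: is_lipschitz_posterior_mean.
  - exact: is_lipschitz_cst.
  by rewrite expect_cst// expect_posterior_mean.
apply: le_expect => //; first exact: is_lipschitz_adv.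
by move=> x; exact/IH/admissible_posterior.
Qed.

(** Write g0, g1, g2 for the sums of a :: b :: A, b :: A and A, and V for
    adv (a :: b :: A) al.  If the bandit with discounts b :: A starts with arm
    1, its advantage is b m + Q1 with m = mu - lam, and by induction
    Q1 <= (g2 / g1) Q, where a m + Q <= V.  Therefore

      b m + Q1 <= (g2 / g1) (a m + Q) + (b - a g2 / g1) m,

    and the coefficient of m equals (g1^2 - g0 g2) / g1, which is nonnegative
    exactly by regularity; as g0 m <= V, this adds up to (g1 / g0) V.
    If it starts with arm 2, its advantage equals the one for A, and the
    induction hypothesis, whose factor g2 / g1 is less than 1, makes it 0. *)
Lemma adv_delay lam a A al : admissible al -> all (> 0) (a :: A) ->
  regular (a :: A) ->
  total (a :: A) * adv lam A al <= total A * adv lam (a :: A) al.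
Proof.
elim: A a al => [|b A IH] a al ala.
  by move=> _ _; rewrite [adv lam [::] al]/= mulr0 mulr_ge0 ?adv_ge0// /total big_nil.
move=> pos reg; have /and3P[a0 b0 A0] : [&& 0 < a, 0 < b & all (> 0) A] := pos.
have bA0 : all (> 0) (b :: A) by rewrite /= b0.
have regb := regular_behead reg.
set g0 := total (a :: b :: A); set g1 := total (b :: A); set g2 := total A.
have g0E : g0 = a + g1 by exact: total_cons.
have g1E : g1 = b + g2 by exact: total_cons.
have g2_ge0 : 0 <= g2 by exact: total_ge0.
have g1_gt0 : 0 < g1 by rewrite g1E ltr_pwDl.
have regE : g0 * g2 <= g1 ^+ 2.
  by have := reg 0; rewrite !discount_tail_cons !discount_tail0.
set m := expect al id - lam.
set V := adv lam (a :: b :: A) al.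
have never : g0 * m <= V by exact: always_pull_le_adv.
have V_ge0 : 0 <= V by exact: adv_ge0.
pose Q := expect al (fun x => adv lam (b :: A) (posterior al x)).
have pullV : a * m + Q <= V by rewrite /V adv_cons le_max lexx.
pose Q1 := expect al (fun x => adv lam A (posterior al x)).
have Q1Q : g1 * Q1 <= g2 * Q.
  rewrite -!expectZ//; try exact: is_lipschitz_adv.
  apply: le_expect => //; try exact/is_lipschitzZ/is_lipschitz_adv.
  by move=> x; apply: IH => //; exact: admissible_posterior.
rewrite [adv lam (b :: A) al]adv_cons; case: (leP (pull_adv lam (b :: A) al)) => [le|_].
  have := IH b al ala bA0 regb.
  rewrite adv_cons max_r// -/g1 -/g2 => h.
  have -> : adv lam A al = 0.
    apply/eqP; rewrite eq_le adv_ge0 andbT.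
    have : b * adv lam A al <= 0 by move: h; rewrite g1E; lra.
    by rewrite pmulr_rle0.
  by rewrite mulr0 mulr_ge0// ltW.
(* All inequalities are multiplied by g0 and g1 to avoid the quotients. *)
rewrite -(ler_pM2l g1_gt0).
have -> : pull_adv lam (b :: A) al = b * m + Q1 by [].
have g0_ge0 : 0 <= g0 by rewrite g0E addr_ge0// ltW.
have h1 : g0 * (g1 * Q1) <= g0 * (g2 * Q) by rewrite ler_wpM2l.
have h2 : (g0 * g2) * (a * m + Q) <= (g0 * g2) * V by rewrite ler_wpM2l// mulr_ge0.
have h3 : (g1 ^+ 2 - g0 * g2) * (g0 * m) <= (g1 ^+ 2 - g0 * g2) * V.
  by rewrite ler_wpM2l// subr_ge0.
have bE : b = g1 - g2 by rewrite g1E addrK.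
have aE : a = g0 - g1 by rewrite g0E addrK.
have -> : g1 * (g0 * (b * m + Q1)) = g0 * (g1 * Q1) - g0 * (g2 * Q)
    + (g0 * g2) * (a * m + Q) + (g1 ^+ 2 - g0 * g2) * (g0 * m).
  by rewrite bE aE; ring.
have -> : g1 * (g1 * V) = (g0 * g2) * V + (g1 ^+ 2 - g0 * g2) * V by ring.
lra.
Qed.

(** * The effect of an observation below the known payoff *)

Lemma pull_adv_posterior lam a A al x : admissible al ->
  (mass al + 1) * pull_adv lam (a :: A) (posterior al x) =
  mass al * (a * (expect al id - lam)
    + expect al (fun z => adv lam A (posterior (posterior al z) x)))
  + a * (x - lam) + adv lam A (posterior (posterior al x) x).
Proof.
move=> ala; rewrite /pull_adv /=.
have Eid := expect_posterior x ala is_lipschitz_id.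
have := expect_posterior x ala (is_lipschitz_adv lam A (admissible_posterior x ala)).
rewrite (_ : (fun z => adv lam A (posterior (posterior al z) x)) =
             (fun t => adv lam A (posterior (posterior al x) t))); last first.
  by apply/funext => z; rewrite posteriorC.
move=> EF; rewrite mulrDr EF mulrCA [_ * (_ - lam)]mulrBr Eid.
by ring.
Qed.

Lemma is_lipschitz_adv_posterior lam A al x : admissible al ->
  is_lipschitz (fun z => adv lam A (posterior (posterior al z) x)).
Proof.
move=> ala; have -> : (fun z => adv lam A (posterior (posterior al z) x)) =
          (fun t => adv lam A (posterior (posterior al x) t)).
  by apply/funext => z; rewrite posteriorC.
exact/is_lipschitz_adv/admissible_posterior.
Qed.

(** The last term is kept because the theorem needs a strict inequality when
    x < lam; the hypothesis on the shorter sequence A makes this lemma serve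
    both as the inductive step of [adv_posterior_le] and as its refinement. *)
Lemma pull_adv_posterior_le lam a A al x : admissible al ->
  (forall be, admissible be -> adv lam A (posterior be x) <= adv lam A be) ->
  (mass al + 1) * pull_adv lam (a :: A) (posterior al x) <=
  (mass al + 1) * adv lam (a :: A) al + a * (x - lam).
Proof.
move=> ala H; rewrite pull_adv_posterior//.
have M0 := mass_gt0 ala.
have h1 : adv lam A (posterior (posterior al x) x) <= adv lam (a :: A) al.
  apply: (le_trans (H _ (admissible_posterior x ala))).
  by apply: (le_trans (H _ ala)); rewrite adv_cons le_max lexx orbT.
have h2 : a * (expect al id - lam)
    + expect al (fun z => adv lam A (posterior (posterior al z) x))
    <= adv lam (a :: A) al.
  rewrite adv_cons le_max; apply/orP; left; rewrite lerD2l.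
  apply: le_expect => //; [exact: is_lipschitz_adv_posterior|exact: is_lipschitz_adv|].
  by move=> z; exact/H/admissible_posterior.
have := ler_wpM2l (ltW M0) h2; lra.
Qed.

(** The atom at x mixes with the draws from al some that are worth no more than
    the known arm and tell nothing about al. *)
Lemma adv_posterior_le lam A al x : admissible al -> all (> 0) A -> x <= lam ->
  adv lam A (posterior al x) <= adv lam A al.
Proof.
move=> + + xlam; elim: A al => //= a A IH al ala /andP[a0 A0].
rewrite -!/(adv lam (a :: A) _) !adv_cons ge_max; apply/andP; split; last first.
  by rewrite le_max IH ?orbT.
have M1 : 0 < mass al + 1 by rewrite addr_gt0// mass_gt0.
rewrite -adv_cons -(ler_pM2l M1).
apply: (le_trans (pull_adv_posterior_le _ ala _)); first by move=> be beA; exact: IH.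
by rewrite gerDl mulr_ge0_le0 ?subr_le0// ltW.
Qed.

End BreakEven.

Theorem proposition1 (R : realType) (n : nat) (A : n.-tuple R)
    (al : {finite_measure set (measurableTypeR R) -> \bar R}) (L b : R)
    (n_ge2 : (2 <= n)%N)
    (A_regular : regular A)
    (A_gt0 : forall i : 'I_n, 0 < tnth A i)
    (al_nonnull : (0 < al setT)%E)
    (al_moment : (\int[al]_(x in setT) `|x|%:E < +oo)%E)
    (L_value : is_break_even_value A al L)
    (b_observation : is_break_even_observation A al b) :
  L <= b.
Proof.
have A0 : all (> 0) A by apply/all_tnthP.
have ala : admissible al.
  by split=> //; rewrite -ge0_fin_numE//; exact: fin_num_measure.
have sA := size_tuple A.
case: b_observation => L' [Lx].
case=> [/is_break_even_value_uniq/(_ L_value) -> Lx_value _ Lx_ge].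
move: A0 A_regular L_value Lx_value sA n_ge2.
case: (tval A) => [|a1 [|a2 B]] /= + reg L_value Lx_value <- //= _.
move=> /and3P[a1_gt0 a2_gt0 B_gt0].
rewrite leNgt; apply/negP => bL.
pose x := (b + L) / 2.
have [bx xL] : b <= x /\ x < L by rewrite /x; lra.
have arm1 : arm1_optimal (a2 :: B) (posterior al x) (known_arm L).
  by apply/(proj1 (Lx_value x L))/Lx_ge.
have arm2 : arm2_optimal (a1 :: a2 :: B) al (known_arm L).
  by apply/(proj2 (L_value L)).
(* Arm 2 is optimal, so a delay costs nothing; as it divides a positive
   advantage by a factor greater than 1, there is no advantage to lose. *)
have adv0 : adv L (a2 :: B) al <= 0.
  have := @adv_delay _ L a1 (a2 :: B) _ ala.
  rewrite (arm2_optimal_adv ala arm2) total_cons /= a1_gt0 a2_gt0.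
  move=> /(_ B_gt0 reg); rewrite mulrDl -lerBrDr subrr pmulr_rle0//.
have := adv_ge0 L (a2 :: B) (posterior al x).
rewrite (arm1_optimal_adv (admissible_posterior x ala) arm1) leNgt => /negP; apply.
have M1 : 0 < mass al + 1 by rewrite addr_gt0// mass_gt0.
rewrite -(pmulr_rlt0 _ M1).
apply: (le_lt_trans (pull_adv_posterior_le _ ala _)).
  by move=> be beA; apply: adv_posterior_le => //; exact: ltW.
rewrite ltr_wnDl//; last by rewrite pmulr_rlt0// subr_lt0.
by rewrite pmulr_rle0.
Qed.
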